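(* Let $M,S,\lambda$ be positive integers with $\lambda\le S\le M-1$. Let $\omega\in\mathbb{T}$ and $\alpha>0$ be such that $$\alpha\le\frac{1}{C(\lambda)\sqrt{M+1}},\qquad\text{where}\quad C(\lambda)=2\pi\sum_{j=0}^{\lambda-1}\binom{\lambda-1}{j}\frac{j^\lambda}{\lambda!}.$$ Assume that $\Omega=\{\omega_j\}_{j=1}^S\subset\mathbb{T}$ (with $|\Omega|=S$) contains the set $$\Lambda=\omega+\Big\{0,\frac{\alpha}{M},\dots,\frac{(\lambda-1)\alpha}{M}\Big\}.$$ Let $\Phi=\Phi(\Omega,M)$ be the $(M+1)\times S$ Vandermonde matrix associated with $\Omega$ and $M$. Then $$\sigma_{\min}(\Phi)\le\binom{2\lambda-2}{\lambda-1}^{-1/2}\,2\sqrt{M+1}\,(2\pi\alpha)^{\lambda-1}.$$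
   Context: $\mathbb{T}=[0,1)$ is the periodic unit interval ($\mathbb{R}/\mathbb{Z}$). $\Phi(\Omega,M)$ has entries $\Phi_{m,j}=e^{-2\pi i m\omega_j}$, $0\le m\le M$, $1\le j\le S$. $\sigma_{\min}(\Phi)=\min_{\|v\|_2=1}\|\Phi v\|_2$. For $\lambda=1$ one has $C(1)=0$ and the upper bound on $\alpha$ is read as $+\infty$ (no restriction). *)

(* Defs.v *)
From HB Require Import structures.
From mathcomp Require Export all_boot all_order all_algebra.
From mathcomp Require Export complex.
From mathcomp Require Export all_classical all_reals all_analysis.
Export numFieldNormedType.Exports.
Export Order.TTheory GRing.Theory Num.Theory.
Set Implicit Arguments.
Unset Strict Implicit.
Unset Printing Implicit Defensive.
Local Open Scope classical_set_scope.
Local Open Scope ring_scope.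
Local Open Scope complex_scope.

(* e^{i t} for real t *)
Definition expi (R : realType) (t : R) : R[i] := cos t +i* sin t.

(* The Euclidean norm on C^n; the library norm on matrices is the sup norm. *)
Definition norm2 (R : realType) (n : nat) (v : 'cV[R[i]]_n) : R :=
  Num.sqrt (\sum_i (Normc.normc (v i ord0)) ^+ 2).

(* For n = 0 there is no unit vector and this is inf set0 = 0; for 0 < n the
   infimum is a minimum, see sigma_min_attained below. *)
Definition sigma_min (R : realType) (m n : nat) (A : 'M[R[i]]_(m, n)) : R :=
  inf [set norm2 (A *m v) | v in [set v : 'cV[R[i]]_n | norm2 v = 1]].

Lemma cvec_ex (R : realType) (n : nat) (v : 'cV[R[i]]_n) :
  exists u : 'rV[R]_(n + n),
    v = \col_j (u ord0 (lshift n j) +i* u ord0 (rshift n j)).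
Proof.
exists (row_mx (\row_j complex.Re (v j ord0)) (\row_j complex.Im (v j ord0))).
apply/matrixP => i j; rewrite [RHS]mxE row_mxEl row_mxEr !mxE (ord1 j).
by case: (v i ord0).
Qed.

Lemma norm2_mul_continuous (R : realType) (m n : nat) (A : 'M[R[i]]_(m, n)) :
  continuous (fun u : 'rV[R]_(n + n) =>
    norm2 (A *m \col_j (u ord0 (lshift n j) +i* u ord0 (rshift n j)))).
Proof.
have cc (i : 'I_(n + n)) : continuous (fun u : 'rV[R]_(n + n) => u ord0 i).
  exact: coord_continuous.
have sumc (k : nat) (f : 'I_k -> 'rV[R]_(n + n) -> R) :
    (forall i, continuous (f i)) -> continuous (fun u => \sum_i f i u).
  move=> cf u; rewrite (_ : (fun u => _) = \sum_(i < k) f i).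
    apply: (big_ind (fun g => {for u, continuous g})).
    - exact: cst_continuous.
    - by move=> g h cg ch; apply: continuousD.
    - by move=> i _; apply: cf.
  by apply/funext => x; rewrite fct_sumE.
rewrite (_ : (fun u : 'rV[R]_(n + n) => _) = (fun u : 'rV[R]_(n + n) =>
   Num.sqrt (\sum_i
    ((\sum_j (complex.Re (A i j) * u ord0 (lshift n j)
             - complex.Im (A i j) * u ord0 (rshift n j))) ^+ 2
    + (\sum_j (complex.Re (A i j) * u ord0 (rshift n j)
             + complex.Im (A i j) * u ord0 (lshift n j))) ^+ 2)))).
  move=> u; apply: (@continuous_comp _ _ _ _ (@Num.sqrt R)); last first.
    exact: sqrt_continuous.
  move: u; apply: (@sumc _ _) => i u.
  have mc (a : R) j : continuous (fun u : 'rV[R]_(n + n) => a * u ord0 j).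
    by move=> x; apply: continuousM; [exact: cst_continuous|exact: cc].
  have sqc (f : 'rV[R]_(n + n) -> R) :
      continuous f -> continuous (fun u => f u ^+ 2).
    by move=> cf x; exact: (continuousM (cf x) (cf x)).
  have addc (f g : 'rV[R]_(n + n) -> R) :
      continuous f -> continuous g -> continuous (fun u => f u + g u).
    by move=> cf cg x; exact: (continuousD (cf x) (cg x)).
  have subc (f g : 'rV[R]_(n + n) -> R) :
      continuous f -> continuous g -> continuous (fun u => f u - g u).
    by move=> cf cg x; exact: (continuousB (cf x) (cg x)).
  move: u; apply: (@addc _ _); apply: sqc; apply: (@sumc _ _) => j.
    by apply: subc; apply: mc.
  by apply: addc; apply: mc.
apply/funext => u; rewrite /norm2; congr Num.sqrt; apply: eq_bigr => i _.
have -> z : Normc.normc z ^+ 2 = complex.Re z ^+ 2 + complex.Im z ^+ 2 :> R.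
  by case: z => a b /=; rewrite sqr_sqrtr // addr_ge0 // sqr_ge0.
rewrite !mxE !raddf_sum /=; congr (_ ^+ 2 + _ ^+ 2); apply: eq_bigr => j _;
  by rewrite !mxE; case: (A i j).
Qed.

Lemma sigma_min_attained (R : realType) (m n : nat) (A : 'M[R[i]]_(m, n)) :
  (0 < n)%N ->
  exists v : 'cV[R[i]]_n, [/\ norm2 v = 1, sigma_min A = norm2 (A *m v)
    & forall v', norm2 v' = 1 -> sigma_min A <= norm2 (A *m v')].
Proof.
move=> n0.
pose cv (u : 'rV[R]_(n + n)) : 'cV[R[i]]_n :=
  \col_j (u ord0 (lshift n j) +i* u ord0 (rshift n j)).
have c1 : continuous (fun u => norm2 (cv u)).
  have := @norm2_mul_continuous R n n 1%:M.
  by under eq_fun do rewrite mul1mx.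
pose B : set 'rV[R]_(n + n) := [set u | norm2 (cv u) = 1].
have B0 : B !=set0.
  have [u Eu] := cvec_ex (delta_mx (Ordinal n0) ord0 : 'cV[R[i]]_n).
  exists u; rewrite /B /= /cv -Eu /norm2 (bigD1 (Ordinal n0)) //= big1.
    by rewrite mxE !eqxx Normc.normc1 expr1n addr0 sqrtr1.
  by move=> i ne; rewrite mxE (negbTE ne) andFb Normc.normc0 expr0n.
have Bcl : closed B.
  have -> : B = (fun u => norm2 (cv u)) @^-1` [set 1] by [].
  by apply: preimage_closed => // x; apply: closed_eq.
have Bbd : bounded_set B.
  exists 1; split; first exact: real1.
  move=> x x1 u /= Bu; apply: le_trans (ltW x1).
  have cu j : `|u ord0 j| <= 1.
    have sq : \sum_i (Normc.normc (cv u i ord0)) ^+ 2 = 1.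
      move: Bu; rewrite /B /= /norm2 => /(congr1 (fun z => z ^+ 2)).
      by rewrite sqr_sqrtr ?expr1n // sumr_ge0 // => i _; rewrite sqr_ge0.
    have nz z : Normc.normc z ^+ 2 = complex.Re z ^+ 2 + complex.Im z ^+ 2 :> R.
      by case: z => a b /=; rewrite sqr_sqrtr // addr_ge0 // sqr_ge0.
    have le1 i : complex.Re (cv u i ord0) ^+ 2 + complex.Im (cv u i ord0) ^+ 2 <= 1.
      rewrite -nz -sq (bigD1 i) //= lerDl sumr_ge0 // => k _.
      exact: sqr_ge0.
    rewrite -(@ler_pXn2r _ 2%N) ?nnegrE // expr1n real_normK ?num_real //.
    rewrite -[j]splitK; case: (fintype.split j) => k /=.
      by have := le1 k; rewrite !mxE /=; apply: le_trans; rewrite lerDl sqr_ge0.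
    by have := le1 k; rewrite !mxE /=; apply: le_trans; rewrite lerDr sqr_ge0.
  by rewrite [leLHS]/Num.norm /= mx_normrE; apply/bigmax_leP; 
    split => // -[a j] _; rewrite (ord1 a).
have [u] := EVT_min_rV B0 (bounded_closed_compact Bbd Bcl)
  (continuous_subspaceT (@norm2_mul_continuous R m n A)).
rewrite inE => Bu minu.
have lb v' : norm2 v' = 1 -> norm2 (A *m cv u) <= norm2 (A *m v').
  have [u' ->] := cvec_ex v'.
  by move=> Bu'; apply: minu; rewrite inE.
have -> : sigma_min A = norm2 (A *m cv u).
  apply/eqP; rewrite eq_le; apply/andP; split.
    apply: ge_inf; last by exists (cv u).
    by exists (norm2 (A *m cv u)) => _ [v' v1 <-]; apply: lb.
  apply: lb_le_inf; first by exists (norm2 (A *m cv u)), (cv u).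
  by move=> _ [v' v1 <-]; apply: lb.
by exists (cv u).
Qed.

(* Points of T = R/Z are represented by their representatives in [0, 1);
   frac is the projection R -> R/Z. *)
Definition frac (R : realType) (x : R) : R := x - (Num.floor x)%:~R.

Definition vandermonde (R : realType) (M S : nat) (om : 'I_S -> R) :
    'M[R[i]]_(M.+1, S) :=
  \matrix_(m < M.+1, j < S) expi (- (2 * pi * m%:R * om j)).

(* const_C R 1 = 0, so an upper bound 1 / (const_C R lam * x) means +oo for
   lam = 1, whereas in Rocq 1 / 0 = 0: it must only be assumed for lam <> 1. *)
Definition const_C (R : realType) (lam : nat) : R :=
  2 * pi * \sum_(j < lam) 'C(lam - 1, j)%:R * (j%:R ^+ lam / (lam`!)%:R).

Definition clump (R : realType) (M lam : nat) (w alpha : R) : set R :=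
  [set frac (w + k%:R * alpha / M%:R) | k in [set k : nat | (k < lam)%N]].

(* Main.v *)
Require Import Defs.
From mathcomp Require Import zify ring lra.
Local Open Scope classical_set_scope.
Local Open Scope ring_scope.

(* The test vector carries the signed binomial coefficients
   (-1)^k 'C(lam - 1, k) on the clump and 0 elsewhere.  Its squared norm is
   'C(2 lam - 2, lam - 1), and the m-th entry of its image is, up to a unimodular
   factor, (1 - e^{i t})^(lam - 1) with t = - 2 pi m alpha / M, whose modulus is
   at most (2 pi alpha)^(lam - 1).  The upper bound on alpha gives
   alpha <= 1 when 1 < lam, so that the points of the clump are distinct
   modulo 1. *)

Lemma expiD (R : realType) (x y : R) : expi (x + y) = expi x * expi y.
Proof.
by rewrite /expi cosD sinD; apply/eqP; rewrite eq_complex /= eqxx addrC eqxx.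
Qed.

Lemma expi0 (R : realType) : expi (0 : R) = 1.
Proof. by rewrite /expi cos0 sin0. Qed.

Lemma expiMn (R : realType) (x : R) n : expi (x *+ n) = expi x ^+ n.
Proof.
by elim: n => [|n IHn]; rewrite ?expi0 // mulrS expiD IHn exprS.
Qed.

Lemma expi_2pi_int (R : realType) (k : int) : expi (2 * pi * k%:~R : R) = 1.
Proof.
have expi_nat n : expi (2 * pi * n%:R : R) = 1.
  by rewrite mulr_natr expiMn mulr_natl /expi cos2pi sin2pi expr1n.
case: k => n; first exact: expi_nat.
rewrite NegzE mulrNz mulrN.
have := expiD R (2 * pi * n.+1%:R) (- (2 * pi * n.+1%:R)).
by rewrite subrr expi0 expi_nat mul1r => <-.
Qed.

(** Since [m] is an integer, so is [m] times the floor of [x]: the two arguments differ by a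
    multiple of 2 pi. Matrix entries thus do not see the reduction modulo 1. *)
Lemma expi_frac (R : realType) (m : nat) (x : R) :
  expi (- (2 * pi * m%:R * frac x)) = expi (- (2 * pi * m%:R * x)).
Proof.
rewrite -[RHS]mulr1 -(expi_2pi_int R (m%:Z * Num.floor x)) -expiD /frac.
by congr expi; rewrite intrM; ring.
Qed.

(** Equal fractional parts make [x - y] an integer, and the only integer of absolute value below 1
    is 0. *)
Lemma frac_inj (R : realType) (x y : R) : frac x = frac y -> `|x - y| < 1 -> x = y.
Proof.
rewrite /frac => E.
have -> : x - y = (Num.floor x - Num.floor y)%:~R.
  rewrite intrD mulrNz; apply/eqP; rewrite -subr_eq0; apply/eqP.
  by rewrite opprB; move: E => /eqP; rewrite -subr_eq0 => /eqP <-; ring.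
rewrite -intr_norm -[1](mulr1z (1 : R)) ltr_int => h.
have /eqP : Num.floor x - Num.floor y = 0 by lia.
by rewrite subr_eq0 => /eqP Ef; move: E; rewrite Ef => /addIr.
Qed.

Lemma normcE2 (R : realType) (z : R[i]) :
  Normc.normc z ^+ 2 = complex.Re z ^+ 2 + complex.Im z ^+ 2.
Proof. by case: z => a b /=; rewrite sqr_sqrtr // addr_ge0 // sqr_ge0. Qed.

Lemma normc_ge0 (R : realType) (z : R[i]) : 0 <= Normc.normc z.
Proof. by case: z => a b /=; exact: sqrtr_ge0. Qed.

Lemma normcX (R : realType) (z : R[i]) n : Normc.normc (z ^+ n) = Normc.normc z ^+ n.
Proof.
by elim: n => [|n IHn]; rewrite ?Normc.normc1 // !exprS Normc.normcM IHn.
Qed.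

Lemma normc_expi (R : realType) (x : R) : Normc.normc (expi x) = 1.
Proof. by rewrite /= cos2Dsin2 sqrtr1. Qed.

(** Oddness reduces to [0 <= x]; there the mean value theorem applies, the derivative [cos] being at
    most 1 in modulus. *)
Lemma normr_sin_le (R : realType) (x : R) : `|sin x| <= `|x|.
Proof.
wlog x0 : x / 0 <= x => [H|].
  have [/H//|/ltW x0] := leP 0 x.
  by rewrite -normrN -sinN -[leRHS]normrN; apply: H; rewrite oppr_ge0.
have [c _] := @MVT_segment R sin cos 0 x x0
  (fun y _ => is_derive_sin y) (continuous_subspaceT (@continuous_sin R)).
by rewrite sin0 !subr0 => ->; rewrite normrM ler_piMl // cos_max.
Qed.

(** A chord is no longer than its arc: the squared modulus is 2 - 2 cos x = 4 sin(x/2)^2, at most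
    x^2. *)
Lemma normc_1Bexpi (R : realType) (x : R) : Normc.normc (1 - expi x) <= `|x|.
Proof.
rewrite -(@ler_pXn2r _ 2%N) ?nnegrE ?normc_ge0 // normcE2 /= sub0r sqrrN.
rewrite real_normK ?num_real //.
have sin2_le : sin (x / 2) ^+ 2 <= (x / 2) ^+ 2.
  rewrite -[leLHS]real_normK ?num_real // -[leRHS]real_normK ?num_real //.
  by rewrite ler_pXn2r ?nnegrE // normr_sin_le.
have xE : x = (x / 2) *+ 2 by rewrite -mulr_natr divfK.
have := cos_mulr2n (x / 2); rewrite -xE -mulr_natr.
by have := cos2Dsin2 x; have := cos2Dsin2 (x / 2); lra.
Qed.

(** Used to turn sums over all nodes into sums over the clump, where the test vector is
    supported. *)
Lemma big_supp_codom (V : nmodType) (I J : finType) (f : I -> J) (F : J -> V) :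
  injective f -> (forall j, j \notin codom f -> F j = 0) ->
  \sum_j F j = \sum_i F (f i).
Proof.
move=> f_inj F0; rewrite (bigID (mem (codom f))) /= [X in _ + X]big1 // addr0.
rewrite -big_uniq ?big_image //=; last by apply/injectiveP.
Qed.

(** By homogeneity of the norm, [v] divided by its norm is an admissible unit vector for the
    infimum. *)
Lemma sigma_min_le (R : realType) (m n : nat) (A : 'M[R[i]]_(m, n)) (v : 'cV_n) :
  0 < norm2 v -> sigma_min A * norm2 v <= norm2 (A *m v).
Proof.
move=> v0.
have norm2Z k c (u : 'cV[R[i]]_k) : norm2 (c *: u) = Normc.normc c * norm2 u.
  rewrite /norm2 -[Normc.normc c]ger0_norm ?normc_ge0 // -sqrtr_sqr.
  rewrite -sqrtrM ?sqr_ge0 // mulr_sumr; congr Num.sqrt.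
  by apply: eq_bigr => i _; rewrite mxE Normc.normcM exprMn.
rewrite -ler_pdivlMr // mulrC.
have normcV : Normc.normc (real_complex R (norm2 v)^-1) = (norm2 v)^-1.
  by rewrite /= expr0n addr0 sqrtr_sqr ger0_norm // invr_ge0 ltW.
apply: ge_inf.
  by exists 0 => _ [u _ <-]; exact: sqrtr_ge0.
exists (real_complex R (norm2 v)^-1 *: v) => /=.
  by rewrite norm2Z normcV mulVf ?gt_eqF.
by rewrite -scalemxAr norm2Z normcV.
Qed.

(** Vandermonde's convolution, after replacing one factor by its mirror image 'C(n, n - k). *)
Lemma sum_sqr_bin n : (\sum_(k < n.+1) 'C(n, k) ^ 2 = 'C(n + n, n))%N.
Proof.
rewrite -binomial.Vandermonde; apply: eq_bigr => k _.
by rewrite bin_sub // -ltnS.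
Qed.

(** The last term of the sum, j = n + 1, is already at least 1/2, because (n+2)! <= 2 (n+1)^(n+2);
    the other terms are nonnegative and 2 pi >= 4. *)
Lemma const_C_ge1 (R : realType) n : 1 <= const_C R n.+2.
Proof.
rewrite /const_C big_ord_recr /= subn1 /= binn mul1r.
have factX : (n.+2`! <= 2 * n.+1 ^ n.+2)%N.
  have fact_leX k : (k`! <= k ^ k)%N.
    elim: k => // k IHk; rewrite factS expnS leq_mul2l (leq_trans IHk) //.
    by case: k {IHk} => // k; rewrite leq_exp2r.
  rewrite factS expnS mulnA leq_mul //; lia.
have h : 2^-1 <= n.+1%:R ^+ n.+2 / n.+2`!%:R :> R.
  rewrite ler_pdivlMr ?ltr0n ?fact_gt0 // ler_pdivrMl ?ltr0n //.
  by rewrite -natrX -natrM ler_nat.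
have h0 : 0 <= \sum_(i < n.+1) ('C(n.+1, i)%:R * (i%:R ^+ n.+2 / (n.+2)`!%:R)) :> R.
  by apply: sumr_ge0 => i _; rewrite mulr_ge0 ?divr_ge0 ?exprn_ge0.
have := pi_ge2 R; nra.
Qed.

Theorem proposition2p10 (R : realType) (M S lam : nat)
    (hM : (0 < M)%N) (hS : (0 < S)%N) (hlam : (0 < lam)%N)
    (hlamS : (lam <= S)%N) (hSM : (S <= M - 1)%N)
    (w alpha : R) (hw : 0 <= w < 1) (halpha : 0 < alpha)
    (hC : lam <> 1%N -> alpha <= 1 / (const_C R lam * Num.sqrt (M + 1)%N%:R))
    (om : 'I_S -> R) (om_inj : injective om)
    (om_T : forall j : 'I_S, 0 <= om j < 1)
    (hclump : clump M lam w alpha `<=` range om) :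
  sigma_min (vandermonde M om)
    <= (Num.sqrt ('C(2 * lam - 2, lam - 1))%N%:R)^-1
       * (2 * Num.sqrt (M + 1)%N%:R) * (2 * pi * alpha) ^+ (lam - 1)%N.
Proof.
case: lam hlam hlamS hC hclump => // n _ hlamS hC hclump.
have -> : (2 * n.+1 - 2 = n + n)%N by lia.
rewrite subn1 /=.
have M0 : 0 < M%:R :> R by rewrite ltr0n.
have sqrtM1 : 1 <= Num.sqrt (M + 1)%:R :> R.
  by rewrite -[leLHS]sqrtr1 ler_wsqrtr // ler1n addn1.
have [f fE] : exists f : 'I_n.+1 -> 'I_S,
    forall k, om (f k) = frac (w + k%:R * alpha / M%:R).
  have ex_f (k : 'I_n.+1) : exists j, om j = frac (w + k%:R * alpha / M%:R).
    have [|j _ jE] := hclump (frac (w + k%:R * alpha / M%:R)); last by exists j.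
    by exists (k : nat) => //=.
  by exists (fun k => projT1 (cid (ex_f k))) => k; case: cid.
have f_inj : injective f.
  move=> k l fkl; apply: val_inj => /=.
  (* For [n = 0] the hypothesis [hC] gives nothing, but there is only one index. *)
  have [n0|n_gt0] := posnP n.
    by have := ltn_ord k; have := ltn_ord l; lia.
  (* Both factors of the denominator in [hC] are at least 1. *)
  have alpha1 : alpha <= 1.
    have n1 : n.+1 <> 1%N by lia.
    apply: le_trans (hC n1) _.
    rewrite div1r invf_le1; last first.
      by rewrite mulr_gt0 ?(lt_le_trans _ sqrtM1) // -(prednK n_gt0)
        (lt_le_trans _ (const_C_ge1 _ _)).
    by rewrite -(prednK n_gt0) -[leLHS]mulr1 ler_pM // const_C_ge1.
  have /frac_inj E := etrans (esym (fE k)) (etrans (congr1 om fkl) (fE l)).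
  have diffE : w + k%:R * alpha / M%:R - (w + l%:R * alpha / M%:R) =
      (k%:R - l%:R) * alpha / M%:R by ring.
  have /E /addrI : `|w + k%:R * alpha / M%:R - (w + l%:R * alpha / M%:R)| < 1.
    rewrite diffE !normrM normfV (gtr0_norm M0) (gtr0_norm halpha).
    rewrite ltr_pdivrMr // mul1r.
    (* The indices are at most [n], and n < S <= M - 1; with [alpha <= 1] the unreduced points are
       less than 1 apart. *)
    have klM : `|k%:R - l%:R| < M%:R :> R.
      have kM : k%:R < M%:R :> R by rewrite ltr_nat; have := ltn_ord k; lia.
      have lM : l%:R < M%:R :> R by rewrite ltr_nat; have := ltn_ord l; lia.
      have k0 : 0 <= k%:R :> R by [].
      have l0 : 0 <= l%:R :> R by [].
      by rewrite ltr_norml; lra.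
    by apply: le_lt_trans klM; rewrite ler_piMr.
  move=> /(mulIf (invr_neq0 (lt0r_neq0 M0))) /(mulIf (lt0r_neq0 halpha)).
  by move=> /eqP; rewrite eqr_nat => /eqP.
pose c (k : 'I_n.+1) : R[i] := (-1) ^+ k * 'C(n, k)%:R.
(* Summing over the fibre of [f] avoids inverting it; by injectivity each fibre has at most one
   element. *)
pose v : 'cV[R[i]]_S := \col_j \sum_(k | f k == j) c k.
have vf k : v (f k) ord0 = c k.
  rewrite mxE (eq_bigl (pred1 k)) ?big_pred1_eq // => l.
  by rewrite /= inj_eq.
have v0 j : j \notin codom f -> v j ord0 = 0.
  move=> jf; rewrite mxE big1 // => k /eqP kj.
  by rewrite -kj codom_f in jf.
have norm_v : norm2 v = Num.sqrt 'C(n + n, n)%:R.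
  congr Num.sqrt; rewrite (big_supp_codom _ _ _ _ _ f_inj) => [|j /v0 ->]; last first.
    by rewrite Normc.normc0 expr0n.
  rewrite -sum_sqr_bin natr_sum; apply: eq_bigr => k _.
  rewrite vf /c Normc.normcM normcX normcN Normc.normc1 expr1n mul1r.
  by rewrite normcMn Normc.normc1 natrX.
have norm_v_gt0 : 0 < norm2 v.
  by rewrite norm_v sqrtr_gt0 ltr0n bin_gt0 leq_addr.
have entry (m : 'I_M.+1) : (vandermonde M om *m v) m ord0 =
    expi (- (2 * pi * m%:R * w)) *
    (1 - expi (- (2 * pi * m%:R * (alpha / M%:R)))) ^+ n.
  rewrite mxE (big_supp_codom _ _ _ _ _ f_inj) => [|j /v0 ->]; last by rewrite mulr0.
  (* The binomial theorem matches both sides term by term: the phase at the k-th clump point is the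
     phase at [w] times the k-th power of a fixed one. *)
  rewrite exprBn mulr_sumr; apply: eq_bigr => k _.
  rewrite vf !mxE fE expi_frac -expiMn expr1n mulr1 /c -[X in _ = _ * X]mulr_natr.
  have -> : - (2 * pi * m%:R * (w + k%:R * alpha / M%:R)) =
      - (2 * pi * m%:R * w) + - (2 * pi * m%:R * (alpha / M%:R)) *+ k.
    by rewrite -[X in _ = _ + X]mulr_natr; ring.
  by rewrite expiD; ring.
have norm_Av : norm2 (vandermonde M om *m v) <=
    Num.sqrt (M + 1)%:R * (2 * pi * alpha) ^+ n.
  have bound_ge0 : 0 <= (2 * pi * alpha) ^+ n.
    by rewrite exprn_ge0 // !mulr_ge0 ?pi_ge0 ?(ltW halpha).
  rewrite -[X in _ * X]ger0_norm // -sqrtr_sqr -sqrtrM // ler_wsqrtr //.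
  rewrite addn1 -[M.+1 in leRHS]card_ord mulr_natl -sumr_const.
  apply: ler_sum => m _.
  rewrite ler_pXn2r ?nnegrE ?normc_ge0 // entry Normc.normcM normc_expi mul1r.
  rewrite normcX; apply: lerXn2r;
    rewrite ?nnegrE ?normc_ge0 ?mulr_ge0 ?pi_ge0 ?(ltW halpha) //.
  apply: le_trans (normc_1Bexpi _ _) _.
  rewrite normrN ger0_norm; last by rewrite !mulr_ge0 ?pi_ge0 ?invr_ge0 // ltW.
  (* Row indices run up to [M], so m / M <= 1. *)
  rewrite -!mulrA !ler_wpM2l ?pi_ge0 // mulrCA ler_piMr ?(ltW halpha) //.
  by rewrite ler_pdivrMr // mul1r ler_nat -ltnS.
have := sigma_min_le _ _ _ (vandermonde M om) _ norm_v_gt0.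
rewrite -ler_pdivlMr // mulrC norm_v => /le_trans; apply.
rewrite -mulrA ler_wpM2l ?invr_ge0 ?sqrtr_ge0 //.
(* The target is now twice the nonnegative bound of [norm_Av]. *)
apply: le_trans norm_Av _; rewrite -[leRHS]mulrA ler_peMl ?ler1n //.
by rewrite mulr_ge0 ?sqrtr_ge0 ?exprn_ge0 ?mulr_ge0 ?pi_ge0 ?(ltW halpha).
Qed.
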